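(* Let $\alpha:I\to M$ be a null Cartan curve on a timelike hypersurface $M^3\subset\mathbb{E}^4_1$, with Cartan frame $\{T,N,B_1,B_2\}$, Cartan curvatures $\kappa_2,\kappa_3$, Darboux frame $\{T,\zeta,e,\eta\}$ and Darboux curvatures $\kappa_g,\kappa_e=\cos\phi,\kappa_n=\sin\phi,\tau_e,\tau_n,\tau^*$. The Cartan frame vectors are expressed in the Darboux frame as $$N=\varepsilon_1\kappa_g\,T+\cos\phi\, e+\sin\phi\,\eta,$$ $$B_1=A_1\,T+\sin\phi\, e-\cos\phi\,\eta,$$ $$B_2=A_2\,T+\varepsilon_1\zeta+(-\varepsilon_1\kappa_e\kappa_g-\kappa_nA_1)\,e+(-\varepsilon_1\kappa_n\kappa_g+\kappa_eA_1)\,\eta,$$ where $A_2=-\tfrac12(\kappa_g^2+A_1^2)$ and the null-shift parameter $A_1(s)$ is fixed (up to the orientation sign) by the pseudo-arc Cartan normalization $\kappa_2^2=\langle N',N'\rangle$, equivalently by the compatibility condition $$\varepsilon_1\kappa_g'+A_1(\phi'+\tau^* )+\tfrac12\bigl(A_1^2+\kappa_g^2\bigr)-\varepsilon_1(\kappa_e\tau_e+\kappa_n\tau_n)=0 .$$ Under this compatibility condition the Cartan relations $N'=\kappa_2B_1-B_2$ and $B_2'=-\kappa_3B_1$ hold; the relation $B_1'=\kappa_3T-\kappa_2N$ holds identically. The Cartan curvatures are $$\kappa_2=-(A_1+\phi'+\tau^* ),\qquad \kappa_3=A_1'+\varepsilon_1\kappa_g(A_1+\kappa_2)-\varepsilon_1(\sin\phi\,\tau_e-\cos\phi\,\tau_n).$$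 Inverting the formulas for $N$ and $B_1$: $$\eta=(\kappa_eA_1-\varepsilon_1\kappa_g\kappa_n)\,T+\kappa_n\,N-\kappa_e\,B_1,\qquad e=-(\varepsilon_1\kappa_e\kappa_g+\kappa_nA_1)\,T+\kappa_e\,N+\kappa_n\,B_1 .$$
   Context: Minkowski space-time $\mathbb{E}^4_1$ is $\mathbb{R}^4$ with the metric $\langle x,y\rangle=-x_1y_1+x_2y_2+x_3y_3+x_4y_4$. A null Cartan curve is a smooth null curve $\alpha:I\to\mathbb{E}^4_1$ ($I$ an interval, $\alpha'\neq0$, $\langle\alpha',\alpha'\rangle=0$) parametrized by pseudo-arc length $s$ (so $\langle\alpha'',\alpha''\rangle=1$), together with its Cartan frame $\{T,N,B_1,B_2\}$, $T=\alpha'$, $N=\alpha''$, where $\langle T,T\rangle=\langle B_2,B_2\rangle=0$, $\langle N,N\rangle=\langle B_1,B_1\rangle=1$, $\langle T,B_2\rangle=1$, all other inner products of frame vectors vanish, $\det(T,N,B_1,B_2)=1$, and $T'=N$, $N'=\kappa_2B_1-B_2$, $B_1'=\kappa_3T-\kappa_2N$, $B_2'=-\kappa_3B_1$ for smooth functions $\kappa_2,\kappa_3$ (the Cartan curvatures). Primes denote $d/ds$. A timelike hypersurface $M^3\subset\mathbb{E}^4_1$ is one with spacelike unit normal $\eta$, $\langle\eta,\eta\rangle=1$. Along a null Cartan curve $\alpha$ in $M$, a Darboux frame $\{T,\zeta,e,\eta\}$ has $T=\alpha'$, $\zeta,e$ tangent to $M$, $\langle T,T\rangle=\langle\zeta,\zeta\rangle=0$,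 $\langle T,\zeta\rangle=\varepsilon_1=\pm1$, $\langle e,e\rangle=\langle\eta,\eta\rangle=1$, all other inner products zero. It satisfies $$T'=\varepsilon_1\kappa_gT+\kappa_ee+\kappa_n\eta,\quad \zeta'=-\varepsilon_1\kappa_g\zeta+\tau_ee+\tau_n\eta,$$ $$e'=-\varepsilon_1\tau_eT-\varepsilon_1\kappa_e\zeta+\tau^*\eta,\quad \eta'=-\varepsilon_1\tau_nT-\varepsilon_1\kappa_n\zeta-\tau^*e,$$ with $\kappa_g=\langle T',\zeta\rangle$, $\kappa_e=\langle T',e\rangle$, $\kappa_n=\langle T',\eta\rangle$, $\tau_e=\langle\zeta',e\rangle$, $\tau_n=\langle\zeta',\eta\rangle$, $\tau^*=\langle e',\eta\rangle$. The normalization $\langle T',T'\rangle=1$ gives $\kappa_e^2+\kappa_n^2=1$, and one writes $\kappa_e=\cos\phi$, $\kappa_n=\sin\phi$ with $\phi$ a smooth function of $s$. The orientation of the Darboux frame is taken compatible with $\det(T,N,B_1,B_2)=1$, i.e. so that the $(e,\eta)$-part of $B_1$ is $\sin\phi\,e-\cos\phi\,\eta$ and not its negative. *)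

(* Defs.v *)
From HB Require Import structures.
From mathcomp Require Export all_boot all_order all_algebra.
From mathcomp Require Export all_classical all_reals all_analysis.

Set Implicit Arguments.
Unset Strict Implicit.
Unset Printing Implicit Defensive.

Import Order.TTheory GRing.Theory Num.Theory.
Import numFieldNormedType.Exports.
Local Open Scope classical_set_scope.
Local Open Scope ring_scope.

(* Coordinates are indexed from 0, so the timelike coordinate x_1 is [x 0 0]. *)
Definition mink {R : realType} (x y : 'rV[R]_4) : R :=
  \sum_(i < 4) (-1) ^+ (i == 0) * x 0 i * y 0 i.

Definition det4 {R : realType} (a b c d : 'rV[R]_4) : R :=
  \det (\matrix_(i < 4) nth 0 [:: a; b; c; d] i).

(* C^oo on a possibly non-open set I of parameters: f is a total function all
   of whose derivatives exist on an open neighbourhood of I.  At an endpoint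
   of an interval, derive1 f is then the one-sided derivative of f restricted
   to I. *)
Definition smooth_on {R : realType} {V : normedModType R}
    (I : set R) (f : R -> V) : Prop :=
  exists U : set R, [/\ open U, I `<=` U &
    forall (n : nat) (s : R), U s -> derivable (derive1n n f) s 1].

(* 'D_v1 ('D_v2 (... F)) for vs = [:: v1; v2; ...] *)
Definition iter_derive {R : realType} (vs : seq 'rV[R]_4) (F : 'rV[R]_4 -> R)
    : 'rV[R]_4 -> R :=
  foldr (fun v G => fun x => 'D_v G x) F vs.

Definition smooth_fun_on {R : realType} (U : set 'rV[R]_4)
    (F : 'rV[R]_4 -> R) : Prop :=
  forall (vs : seq 'rV[R]_4) (x : 'rV[R]_4),
    U x -> differentiable (iter_derive vs F) x.

(* M is locally a regular level set of a smooth function. *)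
Definition hypersurface {R : realType} (M : set 'rV[R]_4) : Prop :=
  forall p, M p -> exists (U : set 'rV[R]_4) (F : 'rV[R]_4 -> R),
    [/\ open U, U p, smooth_fun_on U F,
        forall x, U x -> (M x <-> F x = 0) &
        forall x, U x -> M x -> exists v, 'D_v F x != 0].

(* Velocities at p of the curves lying in M. *)
Definition tangent {R : realType} (M : set 'rV[R]_4) (p v : 'rV[R]_4) : Prop :=
  exists c : R -> 'rV[R]_4,
    [/\ c 0 = p, (\forall t \near (0 : R), M (c t)) & is_derive (0 : R) 1 c v].

Definition unit_normal {R : realType} (M : set 'rV[R]_4) (p n : 'rV[R]_4)
    : Prop :=
  (forall v, tangent M p v -> mink n v = 0) /\ mink n n = 1.

Definition timelike_hypersurface {R : realType} (M : set 'rV[R]_4) : Prop :=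
  hypersurface M /\ forall p, M p -> exists n, unit_normal M p n.

Record null_cartan_curve {R : realType} (I : set R) (alpha : R -> 'rV[R]_4)
    : Prop := NullCartanCurve {
  ncc_smooth : smooth_on I alpha;
  ncc_regular : forall s, I s -> derive1 alpha s != 0;
  ncc_null : forall s, I s -> mink (derive1 alpha s) (derive1 alpha s) = 0;
  ncc_pseudo_arc : forall s, I s ->
    mink (derive1n 2 alpha s) (derive1n 2 alpha s) = 1 }.

Record cartan_frame {R : realType} (I : set R)
    (alpha T N B1 B2 : R -> 'rV[R]_4) (kappa2 kappa3 : R -> R)
    : Prop := CartanFrame {
  cf_smooth : [/\ smooth_on I T, smooth_on I N, smooth_on I B1 &
                  smooth_on I B2];
  cf_smooth_curvatures : smooth_on I kappa2 /\ smooth_on I kappa3;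
  cf_T : forall s, I s -> T s = derive1 alpha s;
  cf_N : forall s, I s -> N s = derive1n 2 alpha s;
  cf_null : forall s, I s -> mink (T s) (T s) = 0 /\ mink (B2 s) (B2 s) = 0;
  cf_unit : forall s, I s -> mink (N s) (N s) = 1 /\ mink (B1 s) (B1 s) = 1;
  cf_TB2 : forall s, I s -> mink (T s) (B2 s) = 1;
  cf_orth : forall s, I s ->
    [/\ mink (T s) (N s) = 0, mink (T s) (B1 s) = 0, mink (N s) (B1 s) = 0,
        mink (N s) (B2 s) = 0 & mink (B1 s) (B2 s) = 0];
  cf_det : forall s, I s -> det4 (T s) (N s) (B1 s) (B2 s) = 1;
  cf_T' : forall s, I s -> derive1 T s = N s;
  cf_N' : forall s, I s -> derive1 N s = kappa2 s *: B1 s - B2 s;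
  cf_B1' : forall s, I s -> derive1 B1 s = kappa3 s *: T s - kappa2 s *: N s;
  cf_B2' : forall s, I s -> derive1 B2 s = - (kappa3 s *: B1 s) }.

Record darboux_frame {R : realType} (I : set R) (M : set 'rV[R]_4)
    (alpha T zeta e eta : R -> 'rV[R]_4) (eps1 : R) : Prop := DarbouxFrame {
  df_smooth : [/\ smooth_on I T, smooth_on I zeta, smooth_on I e &
                  smooth_on I eta];
  df_T : forall s, I s -> T s = derive1 alpha s;
  df_tangent : forall s, I s ->
    tangent M (alpha s) (zeta s) /\ tangent M (alpha s) (e s);
  df_normal : forall s, I s -> unit_normal M (alpha s) (eta s);
  df_eps1 : eps1 = 1 \/ eps1 = -1;
  df_null : forall s, I s ->
    mink (T s) (T s) = 0 /\ mink (zeta s) (zeta s) = 0;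
  df_Tzeta : forall s, I s -> mink (T s) (zeta s) = eps1;
  df_unit : forall s, I s -> mink (e s) (e s) = 1 /\ mink (eta s) (eta s) = 1;
  df_orth : forall s, I s ->
    [/\ mink (T s) (e s) = 0, mink (T s) (eta s) = 0,
        mink (zeta s) (e s) = 0, mink (zeta s) (eta s) = 0 &
        mink (e s) (eta s) = 0] }.

(* <X', Y>; the six Darboux curvatures are of this form. *)
Definition connection_coef {R : realType} (X Y : R -> 'rV[R]_4) (s : R) : R :=
  mink (derive1 X s) (Y s).

(* Compatibility of the orientation of (T, zeta, e, eta) with
   det(T, N, B1, B2) = 1.  Modulo T (and, for the last vector, also e and eta)
   one has N = cos phi e + sin phi eta, B2 = eps1 zeta and
   B1 = delta (sin phi e - cos phi eta) with delta = +-1, whence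
   1 = det(T, N, B1, B2) = - delta eps1 det(T, zeta, e, eta);
   the condition below selects delta = 1. *)
Definition compatible_orientation {R : realType} (I : set R)
    (T zeta e eta : R -> 'rV[R]_4) (eps1 : R) : Prop :=
  forall s, I s -> eps1 * det4 (T s) (zeta s) (e s) (eta s) < 0.

(* Main.v *)
Require Import Defs.
From mathcomp Require Import all_boot all_order all_algebra.
From mathcomp Require Import all_classical all_reals all_analysis.
From mathcomp Require Import ring lra.
Import Order.TTheory GRing.Theory Num.Theory.
Import numFieldNormedType.Exports.
Local Open Scope classical_set_scope.
Local Open Scope ring_scope.

                                                                         
                                                                          
                                                                  
                                                                               
                            

                                                                           
                                                                               
                                                                         
                                                                         
                                                                            
                                                                             
                   

                                                                 
                                                       
                                                                               
                                                                              
                                                                        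
                                                          
                                                                              
                                                        
                            

                                                   
                                                                             
                                                                               
                                                                              
                                                            
                                                                              
                                                                
                          

                              

Lemma minkE (R : realType) (x y : 'rV[R]_4) :
  mink x y = - (x 0 0 * y 0 0) + x 0 1 * y 0 1
             + x 0 2%:R * y 0 2%:R + x 0 3%:R * y 0 3%:R.
Proof.
rewrite /mink !big_ord_recl big_ord0 /=.
rewrite !expr0 expr1 !mul1r addr0 mulN1r mulNr !addrA.
by congr (- (_ * _) + _ * _ + _ * _ + _ * _); congr (fun_of_matrix _ _ _);
  apply/val_inj.
Qed.

Lemma minkC (R : realType) (x y : 'rV[R]_4) : mink x y = mink y x.
Proof. by rewrite !minkE; ring. Qed.

Lemma minkDl (R : realType) (x y z : 'rV[R]_4) :
  mink (x + y) z = mink x z + mink y z.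
Proof. by rewrite !minkE !mxE; ring. Qed.

Lemma minkZl (R : realType) (a : R) (x z : 'rV[R]_4) :
  mink (a *: x) z = a * mink x z.
Proof. by rewrite !minkE !mxE; ring. Qed.

Lemma minkNl (R : realType) (x z : 'rV[R]_4) : mink (- x) z = - mink x z.
Proof. by rewrite !minkE !mxE; ring. Qed.

Lemma minkDr (R : realType) (x y z : 'rV[R]_4) :
  mink z (x + y) = mink z x + mink z y.
Proof. by rewrite minkC minkDl !(minkC _ z). Qed.

Lemma minkZr (R : realType) (a : R) (x z : 'rV[R]_4) :
  mink z (a *: x) = a * mink z x.
Proof. by rewrite minkC minkZl (minkC _ z). Qed.

Lemma minkNr (R : realType) (x z : 'rV[R]_4) : mink z (- x) = - mink z x.
Proof. by rewrite minkC minkNl (minkC _ z). Qed.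

Definition mink_lin := (@minkDl, @minkDr, @minkNl, @minkNr, @minkZl, @minkZr).

                                     

                                                                                    
                                                                        
Fixpoint laplace {R : realType} (m : nat) (F : nat -> nat -> R) : R :=
  if m is m'.+1 then
    \sum_(j < m) (-1) ^+ j * F 0%N j
       * laplace m' (fun i k => F i.+1 (bump j k))
  else 1.

Lemma det_laplace (R : realType) (m : nat) (F : nat -> nat -> R) :
  \det (\matrix_(i < m, j < m) F i j) = laplace m F.
Proof.
elim: m F => [|m IH] F; first exact: det_mx00.
rewrite (expand_det_row _ ord0) [RHS]/=; apply: eq_bigr => j _.
rewrite mxE /cofactor.
rewrite add0n mulrCA mulrA -IH; congr (_ * \det _).
by apply/matrixP => i k; rewrite !mxE.
Qed.

Lemma det4E (R : realType) (a b c d : 'rV[R]_4) :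
  det4 a b c d =
    let m2 (i j : 'I_4) := c 0 i * d 0 j - c 0 j * d 0 i in
    let m3 (i j k : 'I_4) :=
      b 0 i * m2 j k - b 0 j * m2 i k + b 0 k * m2 i j in
    a 0 0 * m3 1 2%:R 3%:R - a 0 1 * m3 0 2%:R 3%:R
    + a 0 2%:R * m3 0 1 3%:R - a 0 3%:R * m3 0 1 2%:R.
Proof.
pose F i j := nth 0 (nth [::] [seq [:: x 0 0; x 0 1; x 0 2%:R; x 0 3%:R]
  | x : 'rV[R]_4 <- [:: a; b; c; d]] i) j.
have -> : det4 a b c d = \det (\matrix_(i < 4, j < 4) F i j).
  congr (\det _); apply/matrixP => i j; rewrite !mxE /F.
  case: i => -[|[|[|[|//]]]] ? /=; case: j => -[|[|[|[|//]]]] ? /=;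
    by congr (_ 0 _); apply/val_inj.
rewrite det_laplace /= !big_ord_recl !big_ord0 /F /bump /=; ring.
Qed.

                                                                               
                                                                             
Lemma det4_combination (R : realType) (t z e n : 'rV[R]_4)
    (k c s a x y : R) (B : 'rV[R]_4) (b w u v : R) :
  B = b *: t + w *: z + u *: e + v *: n ->
  det4 t (k *: t + c *: e + s *: n) (a *: t + x *: e + y *: n) B
  = w * (c * y - s * x) * det4 t z e n.
Proof. by move=> ->; rewrite !det4E /= !mxE; ring. Qed.

                                                                                 
                                                                 
Lemma mink_nondegenerate (R : realType) (a b c d x : 'rV[R]_4) :
  det4 a b c d != 0 ->
  mink x a = 0 -> mink x b = 0 -> mink x c = 0 -> mink x d = 0 -> x = 0.
Proof.
move=> D0 xa xb xc xd.
pose D : 'M[R]_4 := \matrix_(i < 4) nth 0 [:: a; b; c; d] i.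
have Du : D \in unitmx by rewrite unitmxE unitfE.
pose J : 'cV[R]_4 := \col_i ((-1) ^+ (i == 0) * x 0 i).
have DJ : D *m J = 0.
  apply/colP => i; rewrite mxE.
  have -> : \sum_j D i j * J j 0 = mink x (nth 0 [:: a; b; c; d] i).
    by apply: eq_bigr => j _; rewrite !mxE mulrC.
  rewrite mxE; case: i => -[|[|[|[|//]]]] ?; assumption.
have J0 : J = 0 by rewrite -(mulKmx Du J) DJ mulmx0.
apply/rowP => i; have /colP/(_ i) := J0; rewrite !mxE => /eqP.
by rewrite mulf_eq0 signr_eq0 => /eqP.
Qed.

                    

                                                                                   
                                                       
Definition null_frame {R : realType} (eps : R) (t z e n : 'rV[R]_4) : Prop :=
  [/\ mink t t = 0, mink z z = 0, mink t z = eps,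
      mink e e = 1 /\ mink n n = 1 &
      [/\ mink t e = 0, mink t n = 0, mink z e = 0, mink z n = 0 &
          mink e n = 0]].

Lemma null_frame_ext (R : realType) (t z e n x y : 'rV[R]_4) :
  det4 t z e n != 0 ->
  mink x t = mink y t -> mink x z = mink y z ->
  mink x e = mink y e -> mink x n = mink y n -> x = y.
Proof.
move=> D0 xt xz xe xn; apply/eqP; rewrite -subr_eq0; apply/eqP.
by apply: (@mink_nondegenerate R t z e n) => //;
  rewrite !mink_lin ?xt ?xz ?xe ?xn subrr.
Qed.

                                                                              
                                            
Lemma null_frame_decomp (R : realType) (eps : R) (t z e n x : 'rV[R]_4) :
  eps = 1 \/ eps = -1 -> null_frame eps t z e n -> det4 t z e n != 0 ->
  x = (eps * mink x z) *: t + (eps * mink x t) *: z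
      + mink x e *: e + mink x n *: n.
Proof.
move=> eps1 [tt zz tz [ee nn] [te tn ze zn en]] D0.
apply/eqP; rewrite -subr_eq0; apply/eqP.
apply: (@mink_nondegenerate R t z e n) => //;
  rewrite !mink_lin ?tt ?zz ?ee ?nn ?tz ?te ?tn ?ze ?zn ?en
    ?(minkC R z t) ?(minkC R e t) ?(minkC R n t) ?(minkC R e z) ?(minkC R n z)
    ?(minkC R n e) ?tz ?te ?tn ?ze ?zn ?en;
  by case: eps1 => epsE; rewrite ?epsE; ring.
Qed.

Lemma null_frame_mink (R : realType) (eps : R) (t z e n x y : 'rV[R]_4) :
  eps = 1 \/ eps = -1 -> null_frame eps t z e n -> det4 t z e n != 0 ->
  mink x y = eps * (mink x z * mink y t + mink x t * mink y z)
             + mink x e * mink y e + mink x n * mink y n.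
Proof.
move=> eps1 F D0; rewrite {1}(@null_frame_decomp R eps t z e n x)// !mink_lin.
by rewrite !(minkC R _ y); ring.
Qed.

                       

                                                                                   
                                                                      
                                       
Definition shifted_N {R : realType} (eps k c s : R) (t e n : 'rV[R]_4) :=
  (eps * k) *: t + c *: e + s *: n.

Definition shifted_B1 {R : realType} (a c s : R) (t e n : 'rV[R]_4) :=
  a *: t + s *: e - c *: n.

Definition shifted_B2 {R : realType} (eps k a c s : R) (t z e n : 'rV[R]_4) :=
  - (2^-1 * (k ^+ 2 + a ^+ 2)) *: t + eps *: z
  + (- (eps * c * k) - s * a) *: e + (- (eps * s * k) + c * a) *: n.

Lemma shifted_N_mink (R : realType) (eps k c s : R) (t z e n : 'rV[R]_4) :
  eps = 1 \/ eps = -1 -> null_frame eps t z e n ->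
  let N := shifted_N eps k c s t e n in
  [/\ mink N t = 0, mink N z = k, mink N e = c & mink N n = s].
Proof.
move=> eps1 [tt zz tz [ee nn] [te tn ze zn en]] N.
split; rewrite /N /shifted_N !mink_lin ?(minkC R e t) ?(minkC R n t)
  ?(minkC R e z) ?(minkC R n z) ?(minkC R n e) ?tt ?tz ?te ?tn ?ze ?zn ?ee ?nn
  ?en; by case: eps1 => epsE; rewrite ?epsE; ring.
Qed.

Lemma shifted_B1_mink (R : realType) (eps a c s : R) (t z e n : 'rV[R]_4) :
  null_frame eps t z e n ->
  let B1 := shifted_B1 a c s t e n in
  [/\ mink B1 t = 0, mink B1 z = eps * a, mink B1 e = s & mink B1 n = - c].
Proof.
move=> [tt zz tz [ee nn] [te tn ze zn en]] B1.
split; rewrite /B1 /shifted_B1 !mink_lin ?(minkC R e t) ?(minkC R n t)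
  ?(minkC R e z) ?(minkC R n z) ?(minkC R n e) ?tt ?tz ?te ?tn ?ze ?zn ?ee ?nn
  ?en; by ring.
Qed.

Lemma shifted_B2_mink (R : realType) (eps k a c s : R) (t z e n : 'rV[R]_4) :
  eps = 1 \/ eps = -1 -> null_frame eps t z e n ->
  let B2 := shifted_B2 eps k a c s t z e n in
  [/\ mink B2 t = 1, mink B2 z = - (eps * (2^-1 * (k ^+ 2 + a ^+ 2))),
      mink B2 e = - (eps * c * k) - s * a &
      mink B2 n = - (eps * s * k) + c * a].
Proof.
move=> eps1 [tt zz tz [ee nn] [te tn ze zn en]] B2.
split; rewrite /B2 /shifted_B2 !mink_lin ?(minkC R e t) ?(minkC R n t)
  ?(minkC R e z) ?(minkC R n z) ?(minkC R n e) ?(minkC R z t) ?tt ?tz ?te ?tn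
  ?ze ?zn ?ee ?nn ?en ?zz; by case: eps1 => epsE; rewrite ?epsE; ring.
Qed.

Lemma shifted_frame (R : realType) (eps k a c s : R) (t z e n : 'rV[R]_4) :
  eps = 1 \/ eps = -1 -> c ^+ 2 + s ^+ 2 = 1 -> null_frame eps t z e n ->
  null_frame 1 t (shifted_B2 eps k a c s t z e n)
    (shifted_N eps k c s t e n) (shifted_B1 a c s t e n).
Proof.
move=> eps1 cs [tt zz tz [ee nn] [te tn ze zn en]].
have {}cs : s ^+ 2 = 1 - c ^+ 2 by rewrite -cs; ring.
split; [| | | split | split];
  rewrite /shifted_N /shifted_B1 /shifted_B2
   ?mink_lin ?tt ?zz ?ee ?nn ?tz ?te ?tn ?ze ?zn ?en
    ?(minkC R z t) ?(minkC R e t) ?(minkC R n t) ?(minkC R e z) ?(minkC R n z)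
    ?(minkC R n e) ?tz ?te ?tn ?ze ?zn ?en;
  by case: eps1 => epsE; rewrite ?epsE; field: cs.
Qed.

Lemma shifted_frame_det4 (R : realType) (eps k a c s : R)
    (t z e n : 'rV[R]_4) :
  c ^+ 2 + s ^+ 2 = 1 ->
  det4 t (shifted_N eps k c s t e n) (shifted_B1 a c s t e n)
    (shifted_B2 eps k a c s t z e n) = - eps * det4 t z e n.
Proof.
move=> cs; rewrite /shifted_B1 -scaleNr (@det4_combination R t z e n _ _ _ _ _ _
  _ _ _ _ _ erefl).
have -> : c * - c - s * s = - (c ^+ 2 + s ^+ 2) by ring.
by rewrite cs; ring.
Qed.

                                                                                  
                                                                            
                                                                             
                                                             
Lemma shifted_frame_unique (R : realType) (eps k c s : R)
    (t z e n N B1 B2 : 'rV[R]_4) :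
  eps = 1 \/ eps = -1 -> c ^+ 2 + s ^+ 2 = 1 -> null_frame eps t z e n ->
  eps * det4 t z e n < 0 -> null_frame 1 t B2 N B1 -> det4 t N B1 B2 = 1 ->
  N = shifted_N eps k c s t e n ->
  B1 = shifted_B1 (eps * mink B1 z) c s t e n /\
  B2 = shifted_B2 eps k (eps * mink B1 z) c s t z e n.
Proof.
move=> eps1 cs F orient [_ b2b2 tb2 [_ b1b1] [tN tb1 b2N b2b1 Nb1]] detC NE.
have D0 : det4 t z e n != 0.
  by apply: contraTneq orient => ->; rewrite mulr0 ltxx.
have mE u v := null_frame_mink R eps t z e n u v eps1 F D0.
have dE u := null_frame_decomp R eps t z e n u eps1 F D0.
have [tt zz tz [ee nn] [te tn ze zn en]] := F.
have epsV : eps * eps = 1 by case: eps1 => ->; ring.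
have Nt : mink N t = 0 by rewrite minkC.
have [Ne Nn Nz] : [/\ mink N e = c, mink N n = s & mink N z = k].
  split; rewrite NE /shifted_N !mink_lin ?(minkC R n e) ?(minkC R e z)
    ?(minkC R n z) ?te ?tn ?tz ?ze ?zn ?ee ?nn ?en; last rewrite mulrAC epsV;
    ring.
have B1t : mink B1 t = 0 by rewrite minkC.
have B2t : mink B2 t = 1 by rewrite minkC.
have := dE B1; have := dE B2.
move: (mE B1 B1) (mE N B1) (mE B2 N) (mE B2 B1) (mE B2 B2).
rewrite b1b1 Nb1 b2N b2b1 b2b2 B1t B2t Nt Ne Nn Nz.
move: (mink B1 e) (mink B1 n) (mink B1 z) (mink B2 e) (mink B2 n) (mink B2 z).
move=> x y a u v w EB1B1 ENB1 EB2N EB2B1 EB2B2 B2E B1E.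
rewrite mulr0 scale0r addr0 in B1E; rewrite mulr1 in B2E.
                                                         
have xE : x = s * (s * x - c * y).
  have -> : s * (s * x - c * y) = (c ^+ 2 + s ^+ 2) * x - c * (c * x + s * y).
    by ring.
  by rewrite cs; move: ENB1; rewrite !(mulr0, mul0r, add0r) => <-; ring.
have yE : y = - (c * (s * x - c * y)).
  have -> : - (c * (s * x - c * y))
    = (c ^+ 2 + s ^+ 2) * y - s * (c * x + s * y) by ring.
  by rewrite cs; move: ENB1; rewrite !(mulr0, mul0r, add0r) => <-; ring.
have dE1 : (s * x - c * y) ^+ 2 = 1.
  have -> : (s * x - c * y) ^+ 2
    = (c ^+ 2 + s ^+ 2) * (x * x + y * y) - (c * x + s * y) ^+ 2 by ring.
  rewrite cs; move: ENB1 EB1B1; rewrite !(mulr0, mul0r, add0r) => <- <-; ring.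
have {dE1} d1 : s * x - c * y = 1.
  move: detC; rewrite {1}NE /shifted_N B1E.
  rewrite (det4_combination _ _ _ _ _ _ _ _ _ _ _ _ _ _ _ _ B2E) => detC.
  move/eqP: dE1; rewrite sqrf_eq1 => /orP[/eqP//|/eqP d1].
  have : eps * det4 t z e n = 1.
    by rewrite -[RHS]detC; rewrite (_ : c * y - s * x = 1) ?mulr1//; lra.
  by move: orient => /[swap] ->; rewrite ltr10.
rewrite d1 mulr1 in xE; rewrite d1 mulr1 in yE; subst x y.
                                                              
                      
have uE : u = - (eps * c * k) - s * (eps * a).
  have -> : u = (c ^+ 2 + s ^+ 2) * u by rewrite cs mul1r.
  have -> : eps * c * k = c * (eps * k) by ring.
  have -> : eps * k = - (u * c + v * s) by lra.
  have -> : eps * a = - (u * s - v * c) by lra.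
  by ring.
have vE : v = - (eps * s * k) + c * (eps * a).
  have -> : v = (c ^+ 2 + s ^+ 2) * v by rewrite cs mul1r.
  have -> : eps * s * k = s * (eps * k) by ring.
  have -> : eps * k = - (u * c + v * s) by lra.
  have -> : eps * a = - (u * s - v * c) by lra.
  by ring.
have wE : eps * w = - (2^-1 * (k ^+ 2 + (eps * a) ^+ 2)).
  have : u * u + v * v = (c ^+ 2 + s ^+ 2) * (eps * eps * k ^+ 2 + (eps * a) ^+ 2).
    by rewrite uE vE; ring.
  by rewrite cs epsV; lra.
split; first by rewrite /shifted_B1 {1}B1E scaleNr.
by rewrite /shifted_B2 {1}B2E wE -uE -vE.
Qed.

Lemma shifted_frame_invert (R : realType) (eps k a c s : R)
    (t e n : 'rV[R]_4) :
  c ^+ 2 + s ^+ 2 = 1 ->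
  let N := shifted_N eps k c s t e n in
  let B1 := shifted_B1 a c s t e n in
  n = (c * a - eps * k * s) *: t + s *: N - c *: B1 /\
  e = - ((eps * c * k + s * a) *: t) + c *: N + s *: B1.
Proof.
move=> cs N B1; split; apply/rowP => i; rewrite !mxE.
  by rewrite -[LHS]mul1r -cs; ring.
by rewrite -[LHS]mul1r -cs; ring.
Qed.

                                                

                                                                                   
                                                                     
Lemma derive1_eq0_on (R : realType) (V : normedModType R) (I : set R)
    (f : R -> V) (s : R) :
  is_interval I -> I^° !=set0 -> I s -> derivable f s 1 ->
  (forall t, I t -> f t = 0) -> derive1 f s = 0.
Proof.
move=> Iint [u Iu] Is df f0.
                                                                        
have [v Iv vs] : exists2 v, I v & v != s.
  have [us|us] := eqVneq u s; last by exists u => //; exact: nbhs_singleton.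
  have [d /= d0 dI] := (nbhs_ballP _ _).1 Iu.
  exists (u + d / 2); last by rewrite us -subr_eq0 addrC addKr gt_eqF ?divr_gt0.
  apply: dI; rewrite /ball /= opprD addNKr normrN gtr0_norm ?divr_gt0//.
  by rewrite ltr_pdivrMr// ltr_pMr// ltr1n.
have seg (r : R) : 0 < r < 1 -> I (r * (v - s) + s).
  move=> /andP[r0 r1]; have [sv|sv] := ltP s v.
    by apply: (Iint s v) => //; apply/andP; split; nra.
  by apply: (Iint v s) => //; apply/andP; split; nra.
rewrite derive1E; apply/eqP/negPn/negP => l0.
have : h^-1 *: ((f \o shift s) (h *: 1) - f s) @[h --> 0^'] --> 'D_1 f s.
  exact: df.
move: ('D_1 f s) l0 => l l0 /cvgrPdist_lt /(_ `|l|).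
rewrite normr_gt0 => /(_ l0) /= [d /= d0 dP].
have vs0 : 0 < `|v - s| by rewrite normr_gt0 subr_eq0.
                                                                          
pose r := Num.min 2^-1 (d / (2 * `|v - s|)).
have r0 : 0 < r by rewrite lt_min invr_gt0 ltr0n divr_gt0 ?mulr_gt0.
have r1 : r < 1 by rewrite gt_min invf_lt1 ?ltr1n.
have := dP (r * (v - s)).
rewrite /ball_ /= sub0r normrN normrM (gtr0_norm r0).
have -> : (r * `|v - s| < d) = true.
  apply: (@le_lt_trans _ _ (d / 2)); last first.
    by rewrite ltr_pdivrMr// ltr_pMr// ltr1n.
  rewrite -ler_pdivlMr//.
  by rewrite /r ge_min -mulrA -invfM lexx orbT.
rewrite mulf_neq0 ?subr_eq0 ?(gt_eqF r0)// => /(_ isT isT).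
rewrite [(_ * _)%:A]mulr1 !f0//; last by apply: seg; rewrite r0 r1.
by rewrite subrr scaler0 subr0 ltxx.
Qed.

Lemma derive1_eq_on (R : realType) (V : normedModType R) (I : set R)
    (f g : R -> V) (s : R) :
  is_interval I -> I^° !=set0 -> I s -> derivable f s 1 -> derivable g s 1 ->
  (forall t, I t -> f t = g t) -> derive1 f s = derive1 g s.
Proof.
move=> Iint I0 Is df dg fg; apply/eqP; rewrite -subr_eq0.
rewrite !derive1E -deriveB// -derive1E; apply/eqP.
apply: (@derive1_eq0_on R V I (f - g)) => // [|t It]; first exact: derivableB.
by rewrite -[LHS]/(f t - g t) fg// subrr.
Qed.

Lemma is_derive_mink (R : realType) (f g : R -> 'rV[R]_4) (s : R) :
  derivable f s 1 -> derivable g s 1 ->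
  is_derive s 1 (fun t => mink (f t) (g t))
    (mink (derive1 f s) (g s) + mink (f s) (derive1 g s)).
Proof.
move=> df dg; have /derivable_mxP dfi := df; have /derivable_mxP dgi := dg.
have coord i : is_derive s 1 (fun t => f t 0 i * g t 0 i)
    (derive1 f s 0 i * g s 0 i + f s 0 i * derive1 g s 0 i).
  rewrite !derive1E (derive_mx df) (derive_mx dg) !mxE.
  have dM := is_deriveM (derivableP (dfi 0 i)) (derivableP (dgi 0 i)).
  apply: (is_derive_eq dM).
  by rewrite addrC mulrC.
rewrite [X in is_derive _ _ X _](_ : _ = (- (fun t => f t 0 0 * g t 0 0))
    + (fun t => f t 0 1 * g t 0 1) + (fun t => f t 0 2%:R * g t 0 2%:R)
    + (fun t => f t 0 3%:R * g t 0 3%:R)); last first.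
  by apply/funext => t; rewrite minkE.
have c0 := coord 0; have c1 := coord 1.
have c2 := coord 2%:R; have c3 := coord 3%:R.
have c0123 := is_deriveD (is_deriveD (is_deriveD (is_deriveN c0) c1) c2) c3.
apply: (is_derive_eq c0123); rewrite !minkE; ring.
Qed.

Lemma derive1_mink_on (R : realType) (I : set R) (f g : R -> 'rV[R]_4)
    (h : R -> R) (s : R) :
  is_interval I -> I^° !=set0 -> I s ->
  derivable f s 1 -> derivable g s 1 -> derivable h s 1 ->
  (forall t, I t -> mink (f t) (g t) = h t) ->
  mink (derive1 f s) (g s) + mink (f s) (derive1 g s) = derive1 h s.
Proof.
move=> Iint I0 Is df dg dh fgh; have [dm m'] := @is_derive_mink R f g s df dg.
by rewrite -m' -derive1E; apply: (@derive1_eq_on R R I).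
Qed.

Lemma derive1_mink_cst (R : realType) (I : set R) (f g : R -> 'rV[R]_4)
    (c s : R) :
  is_interval I -> I^° !=set0 -> I s ->
  derivable f s 1 -> derivable g s 1 ->
  (forall t, I t -> mink (f t) (g t) = c) ->
  mink (derive1 f s) (g s) = - mink (derive1 g s) (f s).
Proof.
move=> Iint I0 Is df dg fgc; apply/eqP; rewrite -addr_eq0 (@minkC _ _ (f s)).
by rewrite (@derive1_mink_on R I f g (cst c))// ?derive1_cst//.
Qed.

Lemma derivable_scale (R : realType) (a : R -> R) (f : R -> 'rV[R]_4) (s : R) :
  derivable a s 1 -> derivable f s 1 -> derivable (fun t => a t *: f t) s 1.
Proof.
move=> da /derivable_mxP df; apply/derivable_mxP => i j.
rewrite [X in derivable X _ _](_ : _ = a * (fun t => f t i j)); last first.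
  by apply/funext => t; rewrite mxE.
exact: derivableM.
Qed.

Lemma is_derive_cos_comp (R : realType) (phi : R -> R) (s : R) :
  derivable phi s 1 ->
  is_derive s 1 (fun t => cos (phi t)) (- sin (phi s) * derive1 phi s).
Proof.
move=> /derivableP dphi; rewrite derive1E.
exact: (is_derive1_comp (is_derive_cos _) dphi).
Qed.

Lemma is_derive_sin_comp (R : realType) (phi : R -> R) (s : R) :
  derivable phi s 1 ->
  is_derive s 1 (fun t => sin (phi t)) (cos (phi s) * derive1 phi s).
Proof.
move=> /derivableP dphi; rewrite derive1E.
exact: (is_derive1_comp (is_derive_sin _) dphi).
Qed.

Lemma derivable_shifted_B1 (R : realType) (a c sn : R -> R)
    (t e n : R -> 'rV[R]_4) (s : R) :
  [/\ derivable a s 1, derivable c s 1 & derivable sn s 1] ->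
  [/\ derivable t s 1, derivable e s 1 & derivable n s 1] ->
  derivable (fun x => shifted_B1 (a x) (c x) (sn x) (t x) (e x) (n x)) s 1.
Proof.
move=> [da dc ds] [dt de dn]; rewrite /shifted_B1.
by apply: derivableB; [apply: derivableD|]; exact: derivable_scale.
Qed.

Lemma derivable_shifted_B2 (R : realType) (eps : R) (k a c sn : R -> R)
    (t z e n : R -> 'rV[R]_4) (s : R) :
  [/\ derivable k s 1, derivable a s 1, derivable c s 1 & derivable sn s 1] ->
  [/\ derivable t s 1, derivable z s 1, derivable e s 1 & derivable n s 1] ->
  derivable (fun x => shifted_B2 eps (k x) (a x) (c x) (sn x)
                        (t x) (z x) (e x) (n x)) s 1.
Proof.
move=> [dk da dc ds] [dt dz de dn]; rewrite /shifted_B2.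
have dscale (x : R) (f : R -> R) : derivable f s 1 ->
  derivable (fun t => x * f t) s 1.
  exact: derivableZ.
have dmul (f g : R -> R) : derivable f s 1 -> derivable g s 1 ->
    derivable (fun t => f t * g t) s 1.
  exact: derivableM.
have dadd (f g : R -> R) : derivable f s 1 -> derivable g s 1 ->
    derivable (fun t => f t + g t) s 1.
  exact: derivableD.
have dopp (f : R -> R) : derivable f s 1 -> derivable (fun t => - f t) s 1.
  exact: derivableN.
have d1 := derivable_scale _ _ _ _
  (dopp _ (dscale 2^-1 _ (dadd _ _ (dmul _ _ dk dk) (dmul _ _ da da)))) dt.
have d2 := derivable_scale _ _ _ _
  (dadd _ _ (dopp _ (dmul _ _ (dscale eps _ dc) dk)) (dopp _ (dmul _ _ ds da)))
  de.
have d3 := derivable_scale _ _ _ _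
  (dadd _ _ (dopp _ (dmul _ _ (dscale eps _ ds) dk)) (dmul _ _ dc da)) dn.
have dz' : derivable (fun t => eps *: z t) s 1 by exact: derivableZ.
exact: (derivableD (derivableD (derivableD d1 dz') d2) d3).
Qed.

                               

                                                                                   
                                                                             
Definition diffn_on {R : realType} {V : normedModType R} (U : set R) (n : nat)
    (f : R -> V) : Prop :=
  forall k, (k <= n)%N -> forall s, U s -> derivable (derive1n k f) s 1.

Lemma diffn_onS (R : realType) (V : normedModType R) (U : set R) (n : nat)
    (f : R -> V) :
  diffn_on U n.+1 f <->
  (forall s, U s -> derivable f s 1) /\ diffn_on U n (derive1 f).
Proof.
split=> [df|[df df'] [|k] kn]; last by rewrite derive1Sn; exact: df'.
  split=> [|k kn]; first exact: (df 0%N).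
  by rewrite -derive1Sn; exact: df.
exact: df.
Qed.

                                                                                
            
Lemma diffn_on_eq (R : realType) (V : normedModType R) (U : set R) (n : nat)
    (f g : R -> V) :
  open U -> (forall s, U s -> f s = g s) -> diffn_on U n f -> diffn_on U n g.
Proof.
move=> Uo; elim: n f g => [|n IH] f g fg.
  move=> df [|//] _ s Us; apply: (near_eq_derivable _ (df 0%N isT s Us)).
  by near=> t; apply: fg; near: t; exact: open_nbhs_nbhs.
move=> /diffn_onS[df df']; apply/diffn_onS; split=> [s Us|].
  apply: (near_eq_derivable _ (df s Us)).
  by near=> t; apply: fg; near: t; exact: open_nbhs_nbhs.
apply: IH df' => s Us; rewrite !derive1E; apply: near_eq_derive.
by near=> t; apply: fg; near: t; exact: open_nbhs_nbhs.
Unshelve. all: by end_near. Qed.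

Lemma diffn_onD (R : realType) (V : normedModType R) (U : set R) (n : nat)
    (f g : R -> V) :
  open U -> diffn_on U n f -> diffn_on U n g -> diffn_on U n (f + g).
Proof.
move=> Uo; elim: n f g => [|n IH] f g.
  move=> df dg [|//] _ s Us.
  by apply: derivableD; [exact: (df 0%N)|exact: (dg 0%N)].
move=> /diffn_onS[df df'] /diffn_onS[dg dg']; apply/diffn_onS; split=> [s Us|].
  by apply: derivableD; [exact: df|exact: dg].
apply: (@diffn_on_eq R V U n _ _ Uo _ (IH _ _ df' dg')) => s Us.
rewrite -[LHS]/(derive1 f s + derive1 g s) !derive1E deriveD//.
  exact: df.
exact: dg.
Qed.

Lemma diffn_on_scaled_mink (R : realType) (U : set R) (n : nat)
    (c : R) (f g : R -> 'rV[R]_4) :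
  open U -> diffn_on U n f -> diffn_on U n g ->
  diffn_on U n (fun t => c * mink (f t) (g t)).
Proof.
have cM (s : R) (f' g' : R -> 'rV[R]_4) : derivable f' s 1 -> derivable g' s 1 ->
  is_derive s 1 (fun t => c * mink (f' t) (g' t))
   (c * (mink (derive1 f' s) (g' s) + mink (f' s) (derive1 g' s))).
  move=> df dg; have dm := @is_derive_mink R f' g' s df dg.
  exact: (is_deriveZ c dm).
move=> Uo; elim: n f g => [|n IH] f g.
  move=> df dg [|//] _ s Us.
  by have [] := cM s f g (df 0%N isT s Us) (dg 0%N isT s Us).
move=> df dg.
have dfn : diffn_on U n f by move=> k kn; apply: df; exact: leqW.
have dgn : diffn_on U n g by move=> k kn; apply: dg; exact: leqW.
move: df dg => /diffn_onS[df df'] /diffn_onS[dg dg'].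
apply/diffn_onS; split=> [s Us|].
  by have [] := cM s f g (df s Us) (dg s Us).
apply: (@diffn_on_eq R R U n _ _ Uo _
  (diffn_onD _ _ _ _ _ _ Uo (IH _ _ df' dgn) (IH _ _ dfn dg'))) => s Us.
rewrite [RHS]derive1E; have [_ ->] := cM s f g (df s Us) (dg s Us).
by rewrite mulrDr.
Qed.

                                                                   
Lemma smooth_on_scaled_mink (R : realType) (I : set R) (c : R)
    (f g : R -> 'rV[R]_4) :
  smooth_on I f -> smooth_on I g -> smooth_on I (fun t => c * mink (f t) (g t)).
Proof.
move=> [U [Uo IU df]] [W [Wo IW dg]]; exists (U `&` W); split.
- exact: openI.
- by move=> s Is; split; [exact: IU|exact: IW].
- move=> n s UWs; apply: (@diffn_on_scaled_mink R (U `&` W) n) => //.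
  + exact: openI.
  + by move=> k _ t [Ut _]; exact: df.
  + by move=> k _ t [_ Wt]; exact: dg.
Qed.

Lemma smooth_on_derivable (R : realType) (V : normedModType R) (I : set R)
    (f : R -> V) (n : nat) (s : R) :
  smooth_on I f -> I s -> derivable (derive1n n f) s 1.
Proof. by move=> [U [_ IU df]] Is; exact/df/IU. Qed.

Lemma derivable_connection_coef (R : realType) (I : set R)
    (X Y : R -> 'rV[R]_4) (s : R) :
  smooth_on I X -> smooth_on I Y -> I s -> derivable (connection_coef X Y) s 1.
Proof.
move=> sX sY Is.
have dX' : derivable (derive1 X) s 1 by exact: (smooth_on_derivable _ _ I X 1).
have dY : derivable Y s 1 by exact: (smooth_on_derivable _ _ I Y 0).
by have [] := is_derive_mink _ _ _ _ dX' dY.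
Qed.

                                              

                                                                              
                                                                               
                                      
Record adapted_frame {R : realType} (I : set R) (eps : R)
    (T zeta e eta N : R -> 'rV[R]_4) (phi : R -> R) : Prop := AdaptedFrame {
  af_interval : is_interval I;
  af_nondegenerate : I^° !=set0;
  af_smooth : [/\ smooth_on I T, smooth_on I zeta, smooth_on I e &
                  smooth_on I eta];
  af_N : smooth_on I N /\ forall s, I s -> derive1 T s = N s;
  af_eps : eps = 1 \/ eps = -1;
  af_frame : forall s, I s -> null_frame eps (T s) (zeta s) (e s) (eta s);
  af_det : forall s, I s -> det4 (T s) (zeta s) (e s) (eta s) != 0;
  af_phi : smooth_on I phi;
  af_cos : forall s, I s -> connection_coef T e s = cos (phi s);
  af_sin : forall s, I s -> connection_coef T eta s = sin (phi s) }.

                                                                              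
                            
Lemma adapted_frame_skew (R : realType) (I : set R) (eps s : R)
    (T zeta e eta N : R -> 'rV[R]_4) (phi : R -> R) :
  adapted_frame I eps T zeta e eta N phi -> I s ->
  [/\ connection_coef T T s = 0, connection_coef zeta zeta s = 0,
      connection_coef e e s = 0 & connection_coef eta eta s = 0] /\
  [/\ connection_coef zeta T s = - connection_coef T zeta s,
      connection_coef e T s = - cos (phi s)
      /\ connection_coef eta T s = - sin (phi s),
      connection_coef e zeta s = - connection_coef zeta e s,
      connection_coef eta zeta s = - connection_coef zeta eta s &
      connection_coef eta e s = - connection_coef e eta s].
Proof.
move=> [Iint I0 [sT sz se sn] _ _ F _ _ cE sE] Is; rewrite -cE// -sE// {cE sE}.
have skew (X Y : R -> 'rV[R]_4) (c : R) : smooth_on I X -> smooth_on I Y ->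
    (forall t, I t -> mink (X t) (Y t) = c) ->
    connection_coef X Y s = - connection_coef Y X s.
  move=> sX sY; apply: derive1_mink_cst => //.
    exact: (@smooth_on_derivable R _ I X 0).
  exact: (@smooth_on_derivable R _ I Y 0).
have self (X : R -> 'rV[R]_4) (c : R) : smooth_on I X ->
    (forall t, I t -> mink (X t) (X t) = c) -> connection_coef X X s = 0.
  by move=> sX XX; have := skew X X c sX sX XX; lra.
split; split.
- by apply: (self T 0) => // t /F[].
- by apply: (self zeta 0) => // t /F[].
- by apply: (self e 1) => // t /F[? ? ? []].
- by apply: (self eta 1) => // t /F[? ? ? []].
- by apply: (skew _ _ eps) => // t It; rewrite minkC; have [] := F t It.
- by split; apply: (skew _ _ 0) => // t It; rewrite minkC;
  have [_ _ _ _ []] := F t It.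
- by apply: (skew _ _ 0) => // t It; rewrite minkC;
  have [_ _ _ _ []] := F t It.
- by apply: (skew _ _ 0) => // t It; rewrite minkC;
  have [_ _ _ _ []] := F t It.
- by apply: (skew _ _ 0) => // t It; rewrite minkC;
  have [_ _ _ _ []] := F t It.
Qed.

Lemma adapted_frame_N (R : realType) (I : set R) (eps s : R)
    (T zeta e eta N : R -> 'rV[R]_4) (phi : R -> R) :
  adapted_frame I eps T zeta e eta N phi -> I s ->
  N s = shifted_N eps (connection_coef T zeta s) (cos (phi s)) (sin (phi s))
          (T s) (e s) (eta s).
Proof.
move=> H Is; have [[TT _ _ _] _] := adapted_frame_skew _ _ _ _ _ _ _ _ _ _ H Is.
case: H => _ _ _ [_ <-]// eps1 F D0 _ <-// <-//.
rewrite [LHS](null_frame_decomp _ _ _ _ _ _ _ eps1 (F s Is) (D0 s Is)).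
by rewrite -!/(connection_coef _ _ _) TT mulr0 scale0r addr0.
Qed.

                                                                              
                                                                           
                                                       
Lemma adapted_frame_derive1_N (R : realType) (I : set R) (eps s : R)
    (T zeta e eta N : R -> 'rV[R]_4) (phi : R -> R) :
  adapted_frame I eps T zeta e eta N phi -> I s ->
  let c := cos (phi s) in let sn := sin (phi s) in
  let k := connection_coef T zeta s in
  let w := derive1 phi s + connection_coef e eta s in
  [/\ connection_coef N T s = -1,
      connection_coef N zeta s = derive1 (connection_coef T zeta) s
        - (c * connection_coef zeta e s + sn * connection_coef zeta eta s)
        + eps * k ^+ 2,
      connection_coef N e s = eps * k * c - sn * w &
      connection_coef N eta s = eps * k * sn + c * w].
Proof.
move=> H Is c sn k w.
have TT0 t (It : I t) : connection_coef T T t = 0.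
  by have [[]] := adapted_frame_skew _ _ _ _ _ _ _ _ _ _ H It.
have NE t := adapted_frame_N _ _ _ t _ _ _ _ _ _ H.
have [[TT zz ee nn] [zT [eT nT] ez nz ne]] :=
  adapted_frame_skew _ _ _ _ _ _ _ _ _ _ H Is.
case: H => Iint I0 [sT sz se sn'] [sN T'] eps1 F D0 sphi cE sE.
have der0 (V : normedModType R) (f : R -> V) : smooth_on I f -> derivable f s 1.
  by move=> sf; apply: (smooth_on_derivable _ _ I f 0).
have [dc c'] := is_derive_cos_comp _ _ _ (der0 _ _ sphi).
have [ds s'] := is_derive_sin_comp _ _ _ (der0 _ _ sphi).
have prod (Y : R -> 'rV[R]_4) (h : R -> R) : smooth_on I Y -> derivable h s 1 ->
    (forall t, I t -> mink (N t) (Y t) = h t) ->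
    connection_coef N Y s = derive1 h s
     - (eps * k * connection_coef Y T s + c * connection_coef Y e s
        + sn * connection_coef Y eta s).
  move=> sY dh hE.
  rewrite -(derive1_mink_on _ I N Y h s Iint I0 Is (der0 _ _ sN) (der0 _ _ sY)
    dh hE).
  rewrite (minkC _ (N s)) NE// /shifted_N !mink_lin -!/(connection_coef _ _ _).
  by rewrite addrK.
split.
- rewrite (prod T (cst 0) sT) => [||t It]; last 2 first.
  + exact: derivable_cst.
  + by rewrite -T'//; exact: TT0.
  by rewrite derive1_cst TT cE// sE// mulr0 !add0r -!expr2 cos2Dsin2.
- rewrite (prod zeta (connection_coef T zeta) sz) => [||t It].
  + by rewrite zT -/k; ring.
  + exact: (derivable_connection_coef _ I).
  + by rewrite -T'.
- rewrite (prod e (fun t => cos (phi t)) se) => [|//|t It].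
    by rewrite derive1E c' ee eT -/c -/sn /w; ring.
  by rewrite -T'// -cE.
- rewrite (prod eta (fun t => sin (phi t)) sn') => [|//|t It].
    by rewrite derive1E s' nn nT ne -/c -/sn /w; ring.
  by rewrite -T'// -sE.
Qed.

                                                                                 
                                                                           
                              
Lemma adapted_frame_derive1_B1 (R : realType) (I : set R) (eps s : R)
    (T zeta e eta N : R -> 'rV[R]_4) (phi A : R -> R) :
  adapted_frame I eps T zeta e eta N phi -> I s -> derivable A s 1 ->
  let c := cos (phi s) in let sn := sin (phi s) in
  let k := connection_coef T zeta s in
  let k2 := - (A s + derive1 phi s + connection_coef e eta s) in
  derive1 (fun t => shifted_B1 (A t) (cos (phi t)) (sin (phi t))
                      (T t) (e t) (eta t)) s =
  (derive1 A s + eps * k * (A s + k2)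
   - eps * (sn * connection_coef zeta e s - c * connection_coef zeta eta s))
    *: T s - k2 *: N s.
Proof.
move=> H Is dA c sn k k2; have NE := adapted_frame_N _ _ _ _ _ _ _ _ _ _ H Is.
have [[TT zz ee nn] [zT [eT nT] ez nz ne]] :=
  adapted_frame_skew _ _ _ _ _ _ _ _ _ _ H Is.
case: H => Iint I0 [sT sz se sn'] [sN T'] eps1 F D0 sphi cE sE.
have der0 (V : normedModType R) (f : R -> V) : smooth_on I f -> derivable f s 1.
  by move=> sf; apply: (smooth_on_derivable _ _ I f 0).
have [dc c'] := is_derive_cos_comp _ _ _ (der0 _ _ sphi).
have [ds s'] := is_derive_sin_comp _ _ _ (der0 _ _ sphi).
set B1 := (fun t : R => shifted_B1 _ _ _ _ _ _).
have dB1 : derivable B1 s 1.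
  by apply: derivable_shifted_B1; split => //; exact: der0.
have B1m t (It : I t) :=
  shifted_B1_mink R eps (A t) (cos (phi t)) (sin (phi t)) _ _ _ _ (F t It).
have prod (Y : R -> 'rV[R]_4) (h : R -> R) : smooth_on I Y -> derivable h s 1 ->
    (forall t, I t -> mink (B1 t) (Y t) = h t) ->
    mink (derive1 B1 s) (Y s) = derive1 h s
     - (A s * connection_coef Y T s + sn * connection_coef Y e s
        - c * connection_coef Y eta s).
  move=> sY dh hE.
  rewrite -(derive1_mink_on _ I B1 Y h s Iint I0 Is dB1 (der0 _ _ sY) dh hE).
  rewrite (minkC _ (B1 s)) {2}/B1 /shifted_B1 !mink_lin.
  by rewrite -!/(connection_coef _ _ _) addrK.
have := shifted_N_mink _ _ k c sn _ _ _ _ eps1 (F s Is).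
rewrite /= -NE => -[NT Nz Ne Nn].
have [tt _ tz _ [te tn _ _ _]] := F s Is.
have epsV : eps * eps = 1 by case: eps1 => ->; ring.
have dcst (x : R) : derivable (cst x : R -> R) s 1 by exact: derivable_cst.
apply: (null_frame_ext _ _ _ _ _ _ _ (D0 s Is));
  rewrite !mink_lin ?tt ?tz ?te ?tn ?NT ?Nz ?Ne ?Nn.
- rewrite (prod T (cst 0) sT (dcst 0)) => [|t /B1m[]//].
  by rewrite derive1_cst TT cE// sE// -/c -/sn; ring.
- have [deA eA'] : is_derive s 1 (eps *: A) (eps *: derive1 A s).
    by rewrite derive1E; apply: is_deriveZ; exact: derivableP.
  rewrite (prod zeta (eps *: A) sz) => [||t /B1m[]//]; last by [].
  rewrite derive1E eA' zT /k2 -/k.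
  by case: eps1 => ->; rewrite -[_ *: _]/(_ * _); ring.
- rewrite (prod e (fun t => sin (phi t)) se) => [|//|t /B1m[]//].
  by rewrite derive1E s' ee eT -/c -/sn /k2; ring.
- rewrite (prod eta (- (fun t => cos (phi t))) sn') => [||t /B1m[]//].
    by rewrite derive1E deriveN// c' nn nT ne -/c -/sn /k2; ring.
  exact: derivableN.
Qed.

Definition compatible_shift {R : realType} (eps : R)
    (T zeta e eta : R -> 'rV[R]_4) (phi : R -> R) (s a : R) : Prop :=
  eps * derive1 (connection_coef T zeta) s
  + a * (derive1 phi s + connection_coef e eta s)
  + 2^-1 * (a ^+ 2 + connection_coef T zeta s ^+ 2)
  - eps * (cos (phi s) * connection_coef zeta e s
           + sin (phi s) * connection_coef zeta eta s) = 0.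

                                                                 
                                                                             
                                                                  
                                                                    
Lemma compatible_shift_normalization (R : realType) (I : set R) (eps s a : R)
    (T zeta e eta N : R -> 'rV[R]_4) (phi : R -> R) :
  adapted_frame I eps T zeta e eta N phi -> I s ->
  (- (a + derive1 phi s + connection_coef e eta s)) ^+ 2
    = mink (derive1 N s) (derive1 N s) <->
  compatible_shift eps T zeta e eta phi s a.
Proof.
move=> H Is; have [NT Nz Ne Nn] := adapted_frame_derive1_N _ _ _ _ _ _ _ _ _ _ H Is.
have [_ _ _ _ eps1 F D0 _ _ _] := H.
rewrite (null_frame_mink _ _ _ _ _ _ _ _ eps1 (F s Is) (D0 s Is)).
rewrite -!/(connection_coef _ _ _) NT Nz Ne Nn /compatible_shift.
move: (derive1 phi s) (derive1 (connection_coef T zeta) s).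
move: (connection_coef T zeta s) (connection_coef zeta e s).
move: (connection_coef zeta eta s) (connection_coef e eta s).
have := cos2Dsin2 (phi s).
move: (cos (phi s)) (sin (phi s)) => c sn cs tn ts k te p' k'.
set lhs := (X in _ = X <-> _).
have -> : lhs = (p' + ts) ^+ 2 - k ^+ 2 - 2 * (eps * (k' - (c * te + sn * tn))).
  have -> : lhs = (c ^+ 2 + sn ^+ 2) * ((eps * k) ^+ 2 + (p' + ts) ^+ 2)
    - 2 * (eps * (k' - (c * te + sn * tn) + eps * k ^+ 2)).
    by rewrite /lhs; ring.
  by rewrite cs; case: eps1 => ->; ring.
by split=> E; lra.
Qed.

                                                                                 
                                                     
Lemma compatible_shift_derive1_N (R : realType) (I : set R) (eps s a : R)
    (T zeta e eta N : R -> 'rV[R]_4) (phi : R -> R) :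
  adapted_frame I eps T zeta e eta N phi -> I s ->
  compatible_shift eps T zeta e eta phi s a ->
  let c := cos (phi s) in let sn := sin (phi s) in
  derive1 N s = - (a + derive1 phi s + connection_coef e eta s)
      *: shifted_B1 a c sn (T s) (e s) (eta s)
    - shifted_B2 eps (connection_coef T zeta s) a c sn
        (T s) (zeta s) (e s) (eta s).
Proof.
move=> H Is Ca c sn.
have [NT Nz Ne Nn] := adapted_frame_derive1_N _ _ _ _ _ _ _ _ _ _ H Is.
have [_ _ _ _ eps1 F D0 _ _ _] := H.
have := shifted_B1_mink _ _ a c sn _ _ _ _ (F s Is).
set B1 := shifted_B1 _ _ _ _ _ _; move: B1 => B1 [B1T B1z B1e B1n].
have := shifted_B2_mink _ _ (connection_coef T zeta s) a c sn _ _ _ _ eps1 (F s Is).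
set B2 := shifted_B2 _ _ _ _ _ _ _ _ _; move: B2 => B2 [B2T B2z B2e B2n].
apply: (null_frame_ext _ _ _ _ _ _ _ (D0 s Is));
  rewrite -!/(connection_coef _ _ _) ?NT ?Nz ?Ne ?Nn !mink_lin ?B1T ?B2T ?B1z
    ?B2z ?B1e ?B2e ?B1n ?B2n -/c -/sn; last 2 first.
- by ring.
- by ring.
- by ring.
- move: Ca; rewrite /compatible_shift -/c -/sn.
  move: (derive1 phi s) (derive1 (connection_coef T zeta) s).
  move: (connection_coef T zeta s) (connection_coef zeta e s).
  move: (connection_coef zeta eta s) (connection_coef e eta s).
  move=> tn ts k te p' k'; case: eps1 => ->; lra.
Qed.

                                                                          
                                                                 
Lemma cartan_equation_B2 (R : realType) (I : set R)
    (T N B1 B2 : R -> 'rV[R]_4) (k2 k3 s : R) :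
  is_interval I -> I^° !=set0 -> I s ->
  [/\ derivable T s 1, derivable N s 1, derivable B1 s 1 & derivable B2 s 1] ->
  (forall t, I t -> null_frame 1 (T t) (B2 t) (N t) (B1 t)) ->
  det4 (T s) (N s) (B1 s) (B2 s) != 0 ->
  derive1 T s = N s -> derive1 N s = k2 *: B1 s - B2 s ->
  derive1 B1 s = k3 *: T s - k2 *: N s ->
  derive1 B2 s = - (k3 *: B1 s).
Proof.
move=> Iint I0 Is [dT dN dB1 dB2] F D0 T' N' B1'.
have skew (X : R -> 'rV[R]_4) c : derivable X s 1 ->
    (forall t, I t -> mink (B2 t) (X t) = c) ->
    mink (derive1 B2 s) (X s) = - mink (derive1 X s) (B2 s).
  by move=> dX; exact: derive1_mink_cst.
have [tt zz tz [ee nn] [te tn ze zn en]] := F s Is.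
apply: (null_frame_ext _ _ _ _ _ _ _ D0).
- rewrite (skew T 1)// => [|t It]; last by rewrite minkC; have [] := F t It.
  by rewrite T' minkC ze !mink_lin (minkC R _ (T s)) tn; ring.
- rewrite (skew N 0)// => [|t It]; last by have [_ _ _ _ []] := F t It.
  rewrite N' !mink_lin (minkC R _ (N s)) en (minkC R (B1 s) (B2 s)) zn zz; ring.
- rewrite (skew B1 0)// => [|t It]; last by have [_ _ _ _ []] := F t It.
  rewrite B1' !mink_lin tz (minkC R (N s)) ze nn; ring.
- have := skew B2 0 dB2; rewrite !mink_lin (minkC R (B1 s)) zn.
  have {}F t : I t -> mink (B2 t) (B2 t) = 0 by move=> /F[].
  by move=> /(_ F); lra.
Qed.

                                                                                    
                         
Lemma adapted_frame_derive1_B2 (R : realType) (I : set R) (eps s : R)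
    (T zeta e eta N : R -> 'rV[R]_4) (phi A : R -> R) :
  adapted_frame I eps T zeta e eta N phi -> I s -> derivable A s 1 ->
  compatible_shift eps T zeta e eta phi s (A s) ->
  let c := cos (phi s) in let sn := sin (phi s) in
  let k := connection_coef T zeta s in
  let k2 := - (A s + derive1 phi s + connection_coef e eta s) in
  derive1 (fun t => shifted_B2 eps (connection_coef T zeta t) (A t)
    (connection_coef T e t) (connection_coef T eta t)
    (T t) (zeta t) (e t) (eta t)) s =
  - ((derive1 A s + eps * k * (A s + k2)
      - eps * (sn * connection_coef zeta e s - c * connection_coef zeta eta s))
     *: shifted_B1 (A s) c sn (T s) (e s) (eta s)).
Proof.
move=> H Is dA Ca c sn k k2.
have B1' := adapted_frame_derive1_B1 _ _ _ _ _ _ _ _ _ _ _ H Is dA.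
have N' := compatible_shift_derive1_N _ _ _ _ _ _ _ _ _ _ _ H Is Ca.
have NE t := adapted_frame_N _ _ _ t _ _ _ _ _ _ H.
case: H => Iint I0 [sT sz se sn'] [sN T'] eps1 F D0 sphi cE sE.
have der0 (V : normedModType R) (f : R -> V) : smooth_on I f -> derivable f s 1.
  by move=> sf; apply: (smooth_on_derivable _ _ I f 0).
have [dc _] := is_derive_cos_comp _ _ _ (der0 _ _ sphi).
have [ds _] := is_derive_sin_comp _ _ _ (der0 _ _ sphi).
have dco Y : smooth_on I Y -> derivable (connection_coef T Y) s 1.
  by move=> sY; exact: (derivable_connection_coef _ I).
have dB1 := derivable_shifted_B1 _ A _ _ T e eta s
  (And3 dA dc ds) (And3 (der0 _ _ sT) (der0 _ _ se) (der0 _ _ sn')).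
have dB2 := derivable_shifted_B2 _ eps (connection_coef T zeta) A _ _
  T zeta e eta s (And4 (dco _ sz) dA (dco _ se) (dco _ sn'))
  (And4 (der0 _ _ sT) (der0 _ _ sz) (der0 _ _ se) (der0 _ _ sn')).
have cs := cos2Dsin2 (phi s).
apply: (cartan_equation_B2 _ I T N _ _ _ _ _ Iint I0 Is
  (And4 (der0 _ _ sT) (der0 _ _ sN) dB1 dB2) _ _ (T' s Is) _ B1').
- move=> t It; rewrite cE// sE// NE//.
  by apply: shifted_frame (F t It) => //; exact: cos2Dsin2.
- rewrite cE// sE// NE// shifted_frame_det4//.
  by rewrite mulNr oppr_eq0 mulf_neq0 ?D0//; case: eps1 => ->;
    rewrite ?oppr_eq0 oner_eq0.
- by rewrite cE// sE//.
Qed.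

                                                                  

Theorem proposition8 (R : realType) (I : set R) (M : set 'rV[R]_4)
    (alpha T N B1 B2 zeta e eta : R -> 'rV[R]_4)
    (kappa2 kappa3 phi : R -> R) (eps1 : R)
    (I_interval : is_interval I) (I_nondegenerate : I^° !=set0)
    (M_timelike : timelike_hypersurface M)
    (alpha_cartan : null_cartan_curve I alpha)
    (alpha_in_M : forall s, I s -> M (alpha s))
    (cartan : cartan_frame I alpha T N B1 B2 kappa2 kappa3)
    (darboux : darboux_frame I M alpha T zeta e eta eps1)
    (phi_smooth : smooth_on I phi)
    (phi_cos : forall s, I s -> connection_coef T e s = cos (phi s))
    (phi_sin : forall s, I s -> connection_coef T eta s = sin (phi s))
    (orientation : compatible_orientation I T zeta e eta eps1) :
  let kappa_g := connection_coef T zeta in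
  let kappa_e := connection_coef T e in
  let kappa_n := connection_coef T eta in
  let tau_e := connection_coef zeta e in
  let tau_n := connection_coef zeta eta in
  let tau_star := connection_coef e eta in
                                                                           
  let frameB1 (A : R -> R) (s : R) : 'rV[R]_4 :=
    A s *: T s + sin (phi s) *: e s - cos (phi s) *: eta s in
  let shift2 (A : R -> R) (s : R) : R :=
    - (2^-1 * (kappa_g s ^+ 2 + A s ^+ 2)) in
  let frameB2 (A : R -> R) (s : R) : 'rV[R]_4 :=
    shift2 A s *: T s + eps1 *: zeta s
    + (- (eps1 * kappa_e s * kappa_g s) - kappa_n s * A s) *: e s
    + (- (eps1 * kappa_n s * kappa_g s) + kappa_e s * A s) *: eta s in
  let curv2 (A : R -> R) (s : R) : R := - (A s + derive1 phi s + tau_star s) in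
  let curv3 (A : R -> R) (s : R) : R :=
    derive1 A s + eps1 * kappa_g s * (A s + curv2 A s)
    - eps1 * (sin (phi s) * tau_e s - cos (phi s) * tau_n s) in
                                                                    
  let compatibility (s a : R) : Prop :=
    eps1 * derive1 kappa_g s + a * (derive1 phi s + tau_star s)
    + 2^-1 * (a ^+ 2 + kappa_g s ^+ 2)
    - eps1 * (kappa_e s * tau_e s + kappa_n s * tau_n s) = 0 in
  [/\                                                    
      exists A1 : R -> R, smooth_on I A1 /\ forall s, I s ->
        [/\ [/\ N s = (eps1 * kappa_g s) *: T s + cos (phi s) *: e s
                      + sin (phi s) *: eta s,
                B1 s = frameB1 A1 s & B2 s = frameB2 A1 s],
            kappa2 s ^+ 2 = mink (derive1 N s) (derive1 N s) /\
              compatibility s (A1 s),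
            kappa2 s = curv2 A1 s /\ kappa3 s = curv3 A1 s,
            eta s = (kappa_e s * A1 s - eps1 * kappa_g s * kappa_n s) *: T s
                    + kappa_n s *: N s - kappa_e s *: B1 s &
            e s = - ((eps1 * kappa_e s * kappa_g s + kappa_n s * A1 s) *: T s)
                  + kappa_e s *: N s + kappa_n s *: B1 s],
                                                                            
                                                                        
      forall s, I s -> forall a : R,
        ((- (a + derive1 phi s + tau_star s)) ^+ 2 = mink (derive1 N s) (derive1 N s)
           <-> compatibility s a) /\
        (compatibility s a <->
           - (a + derive1 phi s + tau_star s) = kappa2 s \/
           - (a + derive1 phi s + tau_star s) = - kappa2 s) &
                                                                      
      forall A : R -> R, smooth_on I A ->
        (forall s, I s ->
           derive1 (frameB1 A) s = curv3 A s *: T s - curv2 A s *: N s) /\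
        ((forall s, I s -> compatibility s (A s)) -> forall s, I s ->
           derive1 N s = curv2 A s *: frameB1 A s - frameB2 A s /\
           derive1 (frameB2 A) s = - (curv3 A s *: frameB1 A s))].
Proof.
move=> kappa_g kappa_e kappa_n tau_e tau_n tau_star frameB1 shift2 frameB2
  curv2 curv3 compatibility.
case: cartan => -[_ sN sB1 sB2] _ _ _ cnull cunit cTB2 corth cdet T' N' B1' B2'.
case: darboux => -[sT sz se sn] _ _ _ eps1E dnull dTz dunit dorth.
have CF s : I s -> null_frame 1 (T s) (B2 s) (N s) (B1 s).
  move=> Is; have [? ?] := cnull s Is; have [? ? ? ? ?] := corth s Is.
  by split; auto; split => //; rewrite minkC.
have F s : I s -> null_frame eps1 (T s) (zeta s) (e s) (eta s).
  by move=> Is; have [? ?] := dnull s Is; split; auto.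
have H : adapted_frame I eps1 T zeta e eta N phi.
  split => // s Is.
  by apply: contraTneq (orientation s Is) => ->; rewrite mulr0 ltxx.
have NE s : I s -> N s = shifted_N eps1 (kappa_g s) (cos (phi s)) (sin (phi s))
                           (T s) (e s) (eta s).
  exact: adapted_frame_N.
have der0 (V : normedModType R) (f : R -> V) s :
    smooth_on I f -> I s -> derivable f s 1.
  exact: (smooth_on_derivable _ _ I f 0).
have compatE s a : I s ->
    compatibility s a <-> compatible_shift eps1 T zeta e eta phi s a.
  by move=> Is; rewrite /compatibility /kappa_e /kappa_n phi_cos// phi_sin.
have N'norm s : I s -> mink (derive1 N s) (derive1 N s) = kappa2 s ^+ 2.
  move=> Is; have [_ b2b2 _ [_ b1b1] [_ _ _ b2b1 _]] := CF s Is.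
  rewrite N'// !mink_lin b2b2 b1b1 b2b1 (minkC _ (B1 s)) b2b1; ring.
split.
                                                                
- pose A1 s := eps1 * mink (B1 s) (zeta s).
  have sA1 : smooth_on I A1 by exact: smooth_on_scaled_mink.
  have unique s (Is : I s) := shifted_frame_unique _ _ _ _ _ _ _ _ _ _ _ _
    eps1E (cos2Dsin2 (phi s)) (F s Is) (orientation s Is) (CF s Is)
    (cdet s Is) (NE s Is).
  exists A1; split=> // s Is; have [B1E B2E] := unique s Is.
  have k2E : kappa2 s = curv2 A1 s.
    have [NT _ Ne Nn] := adapted_frame_derive1_N _ _ _ _ _ _ _ _ _ _ H Is.
    have [_ _ _ [_ b1b1] [_ _ _ b2b1 _]] := CF s Is.
                                                                               
    have <- : connection_coef N B1 s = kappa2 s.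
      by rewrite /connection_coef N'// !mink_lin b1b1 b2b1; ring.
    rewrite /connection_coef B1E /shifted_B1 !mink_lin.
    rewrite -!/(connection_coef _ _ _) NT Ne Nn /curv2 /A1 -/tau_star.
    have := cos2Dsin2 (phi s); set c := cos _; set d := sin _ => cs.
    transitivity (- A1 s - (c ^+ 2 + d ^+ 2) * (derive1 phi s + tau_star s)).
      by rewrite /A1; ring.
    by rewrite cs /A1; ring.
  have tb2 := cTB2 s Is; have [_ _ _ nb2 _] := corth s Is.
  have k3E : kappa3 s = curv3 A1 s.
    have dA1 := der0 _ _ _ sA1 Is; have dB1 := der0 _ _ _ sB1 Is.
    have dB1A : derivable (frameB1 A1) s 1.
      have [dc _] := is_derive_cos_comp _ _ _ (der0 _ _ _ phi_smooth Is).
      have [ds _] := is_derive_sin_comp _ _ _ (der0 _ _ _ phi_smooth Is).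
      exact: (derivable_shifted_B1 _ _ _ _ _ _ _ _ (And3 dA1 dc ds)
        (And3 (der0 _ _ _ sT Is) (der0 _ _ _ se Is) (der0 _ _ _ sn Is))).
                                                                                 
    have B1A' := derive1_eq_on _ _ I B1 (frameB1 A1) s I_interval
      I_nondegenerate Is dB1 dB1A (fun t It => (unique t It).1).
    have := adapted_frame_derive1_B1 _ _ _ _ _ _ _ _ _ _ _ H Is dA1.
    rewrite -/(frameB1 A1) -B1A' B1'// => /(congr1 (mink^~ (B2 s))).
                                                           
    by rewrite !mink_lin tb2 nb2 !mulr0 !oppr0 !addr0 !mulr1.
  have := shifted_frame_invert _ eps1 (kappa_g s) (A1 s) _ _ (T s) (e s) (eta s)
    (cos2Dsin2 (phi s)).
  rewrite /= -NE// -[shifted_B1 _ _ _ _ _ _]B1E => -[etaE eE].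
  split.
  + split; [exact: NE|exact: B1E|].
    by rewrite /frameB2 /kappa_e /kappa_n phi_cos// phi_sin.
  + split; first by rewrite N'norm.
    apply/compatE => //.
    apply/(compatible_shift_normalization _ _ _ _ _ _ _ _ _ _ _ H Is).
    by rewrite N'norm// k2E.
  + by [].
  + by rewrite /kappa_e /kappa_n phi_cos// phi_sin.
  + by rewrite /kappa_e /kappa_n phi_cos// phi_sin.
- move=> s Is a; rewrite compatE//.
  have norm := compatible_shift_normalization _ _ _ _ a _ _ _ _ _ _ H Is.
  split=> //; rewrite -norm N'norm//.
  split=> [/eqP|[->|->]]; [|by []|by rewrite sqrrN].
  by rewrite eqf_sqr => /orP[/eqP|/eqP]; auto.
- move=> A sA; have dA s (Is : I s) := der0 _ _ _ sA Is.
  split=> [s Is|C s Is].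
    exact: (adapted_frame_derive1_B1 _ _ _ _ _ _ _ _ _ _ _ H Is (dA s Is)).
  have Cs := (compatE s (A s) Is).1 (C s Is); split.
    rewrite (compatible_shift_derive1_N _ _ _ _ _ _ _ _ _ _ _ H Is Cs).
    by rewrite /frameB2 /kappa_e /kappa_n phi_cos// phi_sin.
  exact: (adapted_frame_derive1_B2 _ _ _ _ _ _ _ _ _ _ _ H Is (dA s Is) Cs).
Qed.
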